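(* Let $\mathcal A$ be a unital $C^*$-algebra with identity $1$ and let $\alpha:\mathcal A\to\mathcal A$ be an endomorphism. There exists a non-degenerate transfer operator for $(\mathcal A,\alpha)$ if and only if $\ker\alpha$ is unital and there exists a conditional expectation $E$ from $\alpha(1)\mathcal A\alpha(1)$ onto $\alpha(\mathcal A)$. More precisely, if $\ker\alpha$ is unital, then there is a one-to-one correspondence between non-degenerate transfer operators $\mathcal L$ for $(\mathcal A,\alpha)$ and conditional expectations $E$ from $\alpha(1)\mathcal A\alpha(1)$ onto $\alpha(\mathcal A)$, established via the formulae $$E=\alpha\circ \mathcal L|_{\alpha(1)\mathcal A\alpha(1)},\qquad \mathcal L(a)=\alpha^{-1}\big(E(\alpha(1)a\alpha(1))\big),\quad a\in\mathcal A,$$ where $\alpha^{-1}$ is the inverse of the isomorphism $\alpha:(\ker\alpha)^\bot\to\alpha(\mathcal A)$.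
   Context: An endomorphism is a $*$-homomorphism $\alpha:\mathcal A\to\mathcal A$, not assumed to be unital or injective. For an ideal $I$ of $\mathcal A$, $I^\bot=\{a\in\mathcal A: aI=0\}$. The kernel $\ker\alpha$ is called unital if it possesses a multiplicative unit as an algebra (the zero ideal counts as unital, with unit $0$). A transfer operator for $(\mathcal A,\alpha)$ is a continuous positive linear map $\mathcal L:\mathcal A\to\mathcal A$ with $\mathcal L(\alpha(a)b)=a\mathcal L(b)$ for all $a,b\in\mathcal A$. It is non-degenerate if $\alpha(\mathcal L(1))=\alpha(1)$; equivalently $\alpha\circ\mathcal L\circ\alpha=\alpha$; equivalently $\alpha\circ\mathcal L$ is a conditional expectation from $\mathcal A$ onto $\alpha(\mathcal A)$. *)

(* Defs.v *)
From HB Require Import structures.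
From mathcomp Require Import all_boot all_order all_algebra.
From mathcomp Require Import complex.
From mathcomp Require Import all_classical all_reals all_analysis.
Set Implicit Arguments.
Unset Strict Implicit.
Unset Printing Implicit Defensive.
Import Order.TTheory GRing.Theory Num.Theory.
Import numFieldNormedType.Exports.
Local Open Scope classical_set_scope.
Local Open Scope ring_scope.

(* A unital C*-algebra, possibly zero, with a norm that takes its (real,
   nonnegative) values in [R[i]]. It is a record over the Banach space structure
   rather than a Hierarchy Builder structure because the latter cannot join
   [completeNormedModType] with a ring structure: [numDomainType] already
   inherits from both a norm and a ring. Rings are [pzRingType] and the scaling
   axioms are explicit because [algType] would exclude the zero algebra. *)
Record cstarAlgType (R : realType) := CStarAlgebra {
  cstar_space : completeNormedModType R[i];
  cstar_one : cstar_space;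
  cstar_mul : cstar_space -> cstar_space -> cstar_space;
  cstar_star : cstar_space -> cstar_space;
  cstar_mulA : associative cstar_mul;
  cstar_mul1l : left_id cstar_one cstar_mul;
  cstar_mul1r : right_id cstar_one cstar_mul;
  cstar_mulDl : left_distributive cstar_mul +%R;
  cstar_mulDr : right_distributive cstar_mul +%R;
  cstar_scaleAl : forall (k : R[i]) a b,
    k *: cstar_mul a b = cstar_mul (k *: a) b;
  cstar_scaleAr : forall (k : R[i]) a b,
    k *: cstar_mul a b = cstar_mul a (k *: b);
  cstar_normM : forall a b, `|cstar_mul a b| <= `|a| * `|b|;
  cstar_starK : involutive cstar_star;
  cstar_starD : {morph cstar_star : a b / a + b};
  cstar_starZ : forall (k : R[i]) a,
    cstar_star (k *: a) = Num.conj k *: cstar_star a;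
  cstar_starM : forall a b,
    cstar_star (cstar_mul a b) = cstar_mul (cstar_star b) (cstar_star a);
  cstar_normE : forall a, `|cstar_mul (cstar_star a) a| = `|a| ^+ 2
}.

Definition cstar_sort (R : realType) (A : cstarAlgType R) : Type :=
  cstar_space A.
Coercion cstar_sort : cstarAlgType >-> Sortclass.

HB.instance Definition _ (R : realType) (A : cstarAlgType R) :=
  CompleteNormedModule.copy (cstar_sort A) (cstar_space A).
HB.instance Definition _ (R : realType) (A : cstarAlgType R) :=
  GRing.Zmodule_isPzRing.Build (cstar_sort A)
    (@cstar_mulA R A) (@cstar_mul1l R A) (@cstar_mul1r R A)
    (@cstar_mulDl R A) (@cstar_mulDr R A).

Definition star (R : realType) (A : cstarAlgType R) : A -> A := @cstar_star R A.

Section Definitions.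
Variables (R : realType) (A : cstarAlgType R).

Definition positive : set A := [set a | exists b, a = star b * b].

Definition star_endomorphism (alpha : A -> A) : Prop :=
  [/\ linear alpha,
      {morph alpha : a b / a * b} &
      {morph alpha : a / star a}].

Definition endo_kernel (alpha : A -> A) : set A := [set a | alpha a = 0].

Definition annihilator (I : set A) : set A :=
  [set a | forall b, I b -> a * b = 0].

Definition unital_subset (I : set A) : Prop :=
  exists2 u, I u & forall a, I a -> u * a = a /\ a * u = a.

Record transfer_operator (alpha L : A -> A) : Prop := TransferOperator {
  transfer_linear : linear L;
  transfer_continuous : continuous L;
  transfer_positive : forall a, positive a -> positive (L a);
  transfer_identity : forall a b, L (alpha a * b) = a * L b
}.

Definition nondegenerate_transfer (alpha L : A -> A) : Prop :=
  transfer_operator alpha L /\ alpha (L 1) = alpha 1.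

Definition corner (p : A) : set A := range (fun a => p * a * p).

Definition to_corner (p a : A) : corner p :=
  SigSub (mem_set (imageT (fun b => p * b * p) a)).

(* A conditional expectation from the *-subalgebra B of A onto the
   *-subalgebra C of B is a map on the subtype B, so that equality of such maps
   is equality on B. Since B carries no algebra structure of its own, the linear
   and C-bimodule conditions quantify over the element of B concerned. *)
Record conditional_expectation (B C : set A) (E : B -> A) : Prop :=
  ConditionalExpectation {
  condexp_sub : C `<=` B;
  condexp_range : forall x : B, C (E x);
  condexp_id : forall x : B, C (\val x) -> E x = \val x;
  condexp_linear : forall (k : R[i]) (x y z : B),
    \val z = k *: \val x + \val y -> E z = k *: E x + E y;
  condexp_positive : forall x : B, positive (\val x) -> positive (E x);
  condexp_contractive : forall x : B, `|E x| <= `|\val x|;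
  condexp_left : forall (c : A) (x y : B),
    C c -> \val y = c * \val x -> E y = c * E x;
  condexp_right : forall (c : A) (x y : B),
    C c -> \val y = \val x * c -> E y = E x * c
}.

Definition kernel_perp_inv (alpha : A -> A) : A -> A :=
  'pinv_(fun=> 0) (annihilator (endo_kernel alpha)) alpha.

Definition expectation_of (alpha L : A -> A) : corner (alpha 1) -> A :=
  fun x => alpha (L (\val x)).

Definition transfer_of (alpha : A -> A) (E : corner (alpha 1) -> A) : A -> A :=
  fun a => kernel_perp_inv alpha (E (to_corner (alpha 1) a)).

Definition nondegenerate_transfers (alpha : A -> A) : set (A -> A) :=
  [set L | nondegenerate_transfer alpha L].

Definition corner_expectations (alpha : A -> A) :
    set (corner (alpha 1) -> A) :=
  [set E | conditional_expectation (range alpha) E].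

End Definitions.
Arguments expectation_of {R A} alpha L _.
Arguments transfer_of {R A} alpha E _.
Arguments corner_expectations {R A} alpha _.

(* Main.v *)
(* For a non-degenerate transfer operator L, every a in ker alpha satisfies
   a = a (1 - L 1), so 1 - L 1 is the unit of the kernel, and E = alpha L is a
   positive alpha(A)-bimodule projection, hence contractive by the
   Kadison-Schwarz inequality. Conversely alpha is injective on the annihilator
   of a unital kernel and reflects positivity there, so that alpha^-1 E is
   positive, and therefore continuous.

   The order on the C*-algebra rests on square roots of 1 - x for |x| <= 1,
   obtained by iteration: a self-adjoint a is the square of a self-adjoint
   element iff |s - a| <= s for some real s, which makes these squares a proper
   cone on which the norm is monotone. That every b^* b lies in this cone is
   Kaplansky's theorem, reduced as usual to the case b^* b <= 0. *)
Require Import Defs.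
From mathcomp Require Import all_boot all_order all_algebra.
From mathcomp Require Import complex.
From mathcomp Require Import all_classical all_reals all_analysis.
From mathcomp Require Import ring lra.
Import Order.TTheory GRing.Theory Num.Theory.
Import numFieldNormedType.Exports.
Local Open Scope classical_set_scope.
Local Open Scope ring_scope.
Set Implicit Arguments.
Unset Strict Implicit.
Unset Printing Implicit Defensive.

(** * Abelian group identities by reflection *)

Inductive zexp := ZVar of nat | ZNil | ZAdd of zexp & zexp | ZOpp of zexp.

Fixpoint zeval (V : zmodType) (e : seq V) (t : zexp) : V :=
  match t with
  | ZVar j => e`_j
  | ZNil => 0
  | ZAdd t1 t2 => zeval e t1 + zeval e t2
  | ZOpp t1 => - zeval e t1
  end.

Fixpoint zcoef (t : zexp) (i : nat) : int :=
  match t with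
  | ZVar j => (j == i)%:Z
  | ZNil => 0
  | ZAdd t1 t2 => zcoef t1 i + zcoef t2 i
  | ZOpp t1 => - zcoef t1 i
  end.

Lemma zevalE (V : zmodType) (e : seq V) (t : zexp) :
  zeval e t = \sum_(i < size e) e`_i *~ zcoef t i.
Proof.
elim: t => [j||t1 IH1 t2 IH2|t IH] /=.
- have [je|je] := ltnP j (size e).
    rewrite (bigD1 (Ordinal je))//= eqxx big1 ?addr0// => i.
    by rewrite -val_eqE /= eq_sym => /negbTE ->.
  rewrite nth_default// big1// => i _.
  by rewrite gtn_eqF// (leq_trans (ltn_ord i)).
- by rewrite big1.
- by rewrite IH1 IH2 -big_split /=; apply: eq_bigr => i _; rewrite mulrzDr.
- by rewrite IH -sumrN; apply: eq_bigr => i _; rewrite mulrNz.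
Qed.

(** Comparing the integer coefficients of finitely many atoms turns an identity in an abelian group
    into a computation. *)
Lemma zeval_eq (V : zmodType) (e : seq V) (t1 t2 : zexp) :
  all (fun i => zcoef t1 i == zcoef t2 i) (iota 0 (size e)) ->
  zeval e t1 = zeval e t2.
Proof.
move=> /allP h; rewrite !zevalE; apply: eq_bigr => i _.
by have /(_ _)/eqP-> := h i; rewrite // mem_iota /= add0n.
Qed.

(* Atoms are compared by unification because equal products may carry
   syntactically different structure instances. *)
Ltac zatom x e :=
  match e with
  | ?y :: _ =>
      let _ := match goal with _ => unify x y end in constr:(0%N)
  | _ :: ?e' => let n := zatom x e' in constr:(n.+1)
  end.

Ltac zmem x e :=
  match e with
  | @nil _ => constr:(false)
  | ?y :: _ =>
      let _ := match goal with _ => unify x y end in constr:(true)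
  | _ :: ?e' => zmem x e'
  end.

Ltac zatoms x e :=
  lazymatch x with
  | (?a + ?b)%R => let e1 := zatoms a e in zatoms b e1
  | (- ?a)%R => zatoms a e
  | 0%R => e
  | _ => lazymatch zmem x e with
         | true => e
         | false => constr:(x :: e)
         end
  end.

Ltac zreify x e :=
  lazymatch x with
  | (?a + ?b)%R =>
      let t1 := zreify a e in let t2 := zreify b e in constr:(ZAdd t1 t2)
  | (- ?a)%R => let t := zreify a e in constr:(ZOpp t)
  | 0%R => constr:(ZNil)
  | _ => let n := zatom x e in constr:(ZVar n)
  end.

Ltac zmod :=
  lazymatch goal with |- @eq ?T ?x ?y =>
    let e0 := zatoms x (@nil T) in
    let e := zatoms y e0 in
    let t1 := zreify x e in
    let t2 := zreify y e in
    refine (@zeval_eq _ e t1 t2 _); vm_compute; exact isT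
  end.

(* Identities of noncommutative rings that hold by distributivity alone. *)
Ltac ncring :=
  rewrite ?(mulrDl, mulrDr, mulrN, mulNr, opprD, opprK, mul1r, mulr1,
            mul0r, mulr0, mulrA);
  zmod.

(** * Norm and involution *)

Section CStarNorm.
Variables (R : realType) (A : cstarAlgType R).
Implicit Types (a b x y z : A) (r s t : R) (k : R[i]).

Lemma scalerAl_cstar k a b : k *: (a * b) = (k *: a) * b.
Proof. exact: cstar_scaleAl. Qed.

Lemma scalerAr_cstar k a b : k *: (a * b) = a * (k *: b).
Proof. exact: cstar_scaleAr. Qed.

Lemma starK a : star (star a) = a.
Proof. exact: cstar_starK. Qed.

Lemma starD a b : star (a + b) = star a + star b.
Proof. exact: cstar_starD. Qed.

Lemma starM a b : star (a * b) = star b * star a.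
Proof. exact: cstar_starM. Qed.

Lemma star0 : star (0 : A) = 0.
Proof. by apply: (addrI (star 0)); rewrite -starD !addr0. Qed.

Lemma starN a : star (- a) = - star a.
Proof. by apply: (addrI (star a)); rewrite -starD !subrr star0. Qed.

Lemma starB a b : star (a - b) = star a - star b.
Proof. by rewrite starD starN. Qed.

Lemma star1 : star (1 : A) = 1.
Proof. by have := starM 1 (star 1); rewrite mul1r !starK mul1r => <-. Qed.

(* Real scalars are kept apart so that [lra] applies to the bookkeeping. *)
Definition rscale r a : A := (real_complex R r : R[i]) *: a.

Lemma rscaleN r a : rscale r (- a) = - rscale r a.
Proof. exact: scalerN. Qed.

Lemma rscaleBr r a b : rscale r (a - b) = rscale r a - rscale r b.
Proof. exact: scalerBr. Qed.

Lemma rscaleDl r s a : rscale (r + s) a = rscale r a + rscale s a.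
Proof. by rewrite /rscale rmorphD scalerDl. Qed.

Lemma rscaleA r s a : rscale r (rscale s a) = rscale (r * s) a.
Proof. by rewrite /rscale scalerA rmorphM. Qed.

Lemma rscale1 a : rscale 1 a = a.
Proof. by rewrite /rscale rmorph1 scale1r. Qed.

Lemma rscale0 a : rscale 0 a = 0.
Proof. by rewrite /rscale rmorph0 scale0r. Qed.

Lemma rscale2 a : rscale 2 a = a + a.
Proof. by rewrite -[2]/(1 + 1) rscaleDl rscale1. Qed.

Lemma rscaleAl r a b : rscale r a * b = rscale r (a * b).
Proof. by rewrite /rscale scalerAl_cstar. Qed.

Lemma rscaleAr r a b : a * rscale r b = rscale r (a * b).
Proof. by rewrite /rscale scalerAr_cstar. Qed.

Lemma starZ k a : star (k *: a) = Num.conj k *: star a.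
Proof. exact: cstar_starZ. Qed.

Lemma star_rscale r a : star (rscale r a) = rscale r (star a).
Proof.
rewrite /rscale starZ; congr (_ *: _); apply: conj_Creal.
by apply/complex_realP; exists r.
Qed.

Lemma gt0_complexE (e : R[i]) :
  0 < e -> exists2 d : R, 0 < d & e = real_complex R d.
Proof.
move=> e0; exists (complex.Re e).
  by move: e0; rewrite ltcE => /andP[].
by rewrite (RRe_real (gtr0_real e0)).
Qed.

Lemma star_addC a : star (a + star a) = a + star a.
Proof. by rewrite starD starK addrC. Qed.

Lemma star_imag a : star ('i *: (a - star a)) = 'i *: (a - star a).
Proof.
by rewrite starZ conjCi starB starK -[in LHS]opprB scalerN scaleNr opprK.
Qed.

(** The norm takes its values in [R[i]]; its real part loses nothing and lies in the reach of [lra]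
    and [nra]. *)
Definition cnorm a : R := complex.Re `|a|.

Lemma cnormE a : `|a| = real_complex R (cnorm a).
Proof. by rewrite /cnorm (RRe_real (normr_real a)). Qed.

Lemma cnorm_ge0 a : 0 <= cnorm a.
Proof. by have := normr_ge0 a; rewrite cnormE -(rmorph0 (real_complex R)) lecR. Qed.

Lemma cnorm0 : cnorm 0 = 0.
Proof. by rewrite /cnorm normr0. Qed.

Lemma cnorm_eq0 a : cnorm a = 0 -> a = 0.
Proof. by move=> a0; apply/eqP; rewrite -normr_eq0 cnormE a0 rmorph0. Qed.

Lemma cnormD a b : cnorm (a + b) <= cnorm a + cnorm b.
Proof. by have := ler_normD a b; rewrite !cnormE -rmorphD lecR. Qed.

Lemma cnormN a : cnorm (- a) = cnorm a.
Proof. by rewrite /cnorm normrN. Qed.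

Lemma cnormM a b : cnorm (a * b) <= cnorm a * cnorm b.
Proof.
by have := @cstar_normM R A a b; rewrite !cnormE -rmorphM lecR; apply.
Qed.

Lemma cnormE2 a : cnorm (star a * a) = cnorm a ^+ 2.
Proof.
by have := @cstar_normE R A a; rewrite !cnormE -rmorphXn /= => /complexI.
Qed.

Lemma cnorm_rscale r a : cnorm (rscale r a) = `|r| * cnorm a.
Proof.
apply: (@complexI R); rewrite rmorphM -!cnormE /rscale normrZ normc_def /=.
by rewrite expr0n addr0 sqrtr_sqr cnormE.
Qed.

Lemma cnormZi a : cnorm ('i *: a) = cnorm a.
Proof. by rewrite /cnorm normrZ normCi mul1r. Qed.

Lemma cnorm_star a : cnorm (star a) = cnorm a.
Proof.
(* Cancel one factor in [cnorm b ^+ 2 = cnorm (star b * b) <= cnorm (star b) * cnorm b]. *)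
have le_star b : cnorm b <= cnorm (star b).
  have [->|b0] := eqVneq (cnorm b) 0; first exact: cnorm_ge0.
  have b_gt0 : 0 < cnorm b by rewrite lt_neqAle eq_sym b0 cnorm_ge0.
  by rewrite -(ler_pM2r b_gt0) -expr2 -cnormE2 cnormM.
by apply/le_anti; rewrite le_star -{2}[a]starK le_star.
Qed.

(** The norm of [1] equals its own square. Equality with [1] would fail in the zero algebra. *)
Lemma cnorm1 : cnorm 1 <= 1.
Proof.
have := cnormE2 1; rewrite star1 mulr1 => h.
have := cnorm_ge0 1; nra.
Qed.

Lemma star_mul_eq0 a : star a * a = 0 -> a = 0.
Proof.
move=> a0; apply: cnorm_eq0; have := cnormE2 a.
by rewrite a0 cnorm0 => /esym/eqP; rewrite sqrf_eq0 => /eqP.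
Qed.

End CStarNorm.
(** * Square roots *)

Section SquareRoot.
Variables (R : realType) (A : cstarAlgType R).
Implicit Types (a b x y z : A) (r s t e : R).

(** The increments of [t] are nonnegative, so [t] converges as a bounded monotone sequence, and its
    tails make [u] a Cauchy sequence. *)
Lemma cvg_dominated (u : nat -> A) (t : nat -> R) M :
  (forall m n, (m <= n)%N -> cnorm (u n - u m) <= t n - t m) ->
  (forall n, t n <= M) ->
  exists l : A, forall e, 0 < e ->
    exists N, forall n, (N <= n)%N -> cnorm (l - u n) < e.
Proof.
move=> ut tM.
have t_nd : nondecreasing_seq t.
  by move=> m n mn; rewrite -subr_ge0 (le_trans (cnorm_ge0 _) (ut _ _ mn)).
have t_cvg : cvgn t.
  by apply: nondecreasing_is_cvgn => //; exists M => _ [n _ <-].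
have u_cvg : cvg (u @ \oo).
  apply: cauchy_cvg; apply: cauchy_exP => _ /gt0_complexE[d d0 ->].
  have [N _ tN] := (cvgrPdist_lt _ _).1 t_cvg _ d0.
  exists (u N); exists N => // n /= Nn.
  rewrite -ball_normE /ball_ /= cnormE ltcR -cnormN opprB.
  apply: le_lt_trans (ut _ _ Nn) _.
  have tl : t n <= limn t by apply: nondecreasing_cvgn_le.
  have := tN N (leqnn N).
  have := ler_norm (limn t - t N).
  move=> h1 h2; lra.
exists (lim (u @ \oo)) => e e0.
have e0' : 0 < real_complex R e by rewrite -(rmorph0 (real_complex R)) ltcR.
have [N _ uN] := (cvgrPdist_lt _ _).1 u_cvg _ e0'.
by exists N => n Nn; have := uN n Nn; rewrite cnormE ltcR.
Qed.

Lemma eq0_of_approx r a :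
  (forall e, 0 < e -> cnorm a <= r * e) -> a = 0.
Proof.
move=> ha; apply: cnorm_eq0; apply/le_anti; rewrite cnorm_ge0 andbT.
apply/ler_addgt0Pr => e e0; rewrite add0r.
have r1 : 0 < `|r| + 1 by have := normr_ge0 r; lra.
have := ha (e / (`|r| + 1)) (divr_gt0 e0 r1).
move=> /le_trans; apply.
rewrite mulrCA ler_piMr ?(ltW e0)// ler_pdivrMr// mul1r.
by have := ler_norm r; lra.
Qed.

Lemma sqrB_sqr x y : x * x - y * y = x * (x - y) + (x - y) * y.
Proof. ncring. Qed.

(* [1 - x] has a square root [1 - y], where [y] is the limit of the iteration
   [y <- (x + y^2) / 2] from [0]; its steps are dominated by those of the
   bounded increasing iteration [t <- (1 + t^2) / 2] of real numbers. *)
Lemma sqrt_one_sub x : cnorm x <= 1 ->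
  exists y, [/\ cnorm y <= 1, (1 - y) * (1 - y) = 1 - x,
    star x = x -> star y = y & forall z, z * x = x * z -> z * y = y * z].
Proof.
move=> x1.
pose f y := rscale 2^-1 (x + y * y).
pose g t : R := 2^-1 * (1 + t * t).
pose u n := iter n f 0; pose t n := iter n g 0.
have t01 n : 0 <= t n <= 1.
  elim: n => [|n /andP[t0 t1]]; first by rewrite lexx ler01.
  by rewrite /= -/(t n) /g; nra.
have ut n : cnorm (u n) <= t n.
  elim: n => [|n IH]; first by rewrite /= cnorm0.
  rewrite /= -/(t n) -/(u n) /f /g cnorm_rscale gtr0_norm ?invr_gt0//.
  rewrite ler_pM2l ?invr_gt0// (le_trans (cnormD _ _))// lerD//.
  by rewrite (le_trans (cnormM _ _))// ler_pM// cnorm_ge0.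
have ut1 n : cnorm (u n.+1 - u n) <= t n.+1 - t n.
  elim: n => [|n IH].
    by rewrite /= !subr0 (ut 1%N).
  rewrite [u n.+2]/(f (u n.+1)) {2}[u n.+1]/(f (u n)).
  rewrite [t n.+2]/(g (t n.+1)) {3}[t n.+1]/(g (t n)).
  rewrite /f -rscaleBr opprD addrACA subrr add0r sqrB_sqr.
  rewrite cnorm_rscale gtr0_norm ?invr_gt0// /g -mulrBr ler_pM2l ?invr_gt0//.
  rewrite (le_trans (cnormD _ _))//.
  have := cnormM (u n.+1) (u n.+1 - u n).
  have := cnormM (u n.+1 - u n) (u n).
  have := ut n; have := ut n.+1.
  have := cnorm_ge0 (u n); have := cnorm_ge0 (u n.+1).
  have := cnorm_ge0 (u n.+1 - u n).
  move: IH.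
  have /andP[] := t01 n; have /andP[] := t01 n.+1.
  set p := t n.+1; set q := t n.
  set a := cnorm (u n.+1 - u n); set b := cnorm (u n.+1); set c := cnorm (u n).
  move=> *; have : a * b <= (p - q) * p by apply: ler_pM.
  have : a * c <= (p - q) * q by apply: ler_pM.
  nra.
have utmn m n : (m <= n)%N -> cnorm (u n - u m) <= t n - t m.
  move=> /subnK <-; elim: (n - m)%N => [|k IH].
    by rewrite add0n !subrr cnorm0.
  rewrite addSn -(subrKA (u (k + m)%N)) (le_trans (cnormD _ _))//.
  by have := ut1 (k + m)%N; lra.
have [y uy] : exists l : A, forall e, 0 < e ->
    exists N, forall n, (N <= n)%N -> cnorm (l - u n) < e.
  by apply: cvg_dominated utmn (_ : forall n, t n <= 1) => n; case/andP: (t01 n).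
(* Closed conditions pass to the limit: a Lipschitz additive map that vanishes along [u] vanishes at
   [y]. It serves below for self-adjointness and for commutation. *)
have u_fix (h : A -> A) r : {morph h : a b / a - b} ->
    (forall a, cnorm (h a) <= r * cnorm a) -> 0 <= r ->
    (forall n, h (u n) = 0) -> h y = 0.
  move=> hB hr r0 hu; apply: (@eq0_of_approx r) => e /uy[N /(_ N (leqnn N)) yN].
  by rewrite -[h y]subr0 -(hu N) -hB (le_trans (hr _))// ler_wpM2l// ltW.
have y1 : cnorm y <= 1.
  apply/ler_addgt0Pr => e /uy[N /(_ N (leqnn N)) yN].
  rewrite -[y](subrK (u N)) (le_trans (cnormD _ _))//.
  by have := ut N; have /andP[] := t01 N; lra.
exists y; split=> //.
- have yE : y + y = x + y * y.
    apply/eqP; rewrite -subr_eq0; apply/eqP.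
    (* The defect is [2 (y - u N.+1)] minus [y * y - u N * u N], and each of these two terms has
       norm at most [2 e]. *)
    apply: (@eq0_of_approx 4) => e /uy[N yN].
    have uE : x = u N.+1 + u N.+1 - u N * u N.
      rewrite [u N.+1]/(f (u N)) -rscale2 rscaleA divff ?pnatr_eq0// rscale1.
      by rewrite addrK.
    have -> : y + y - (x + y * y) =
        (y - u N.+1) + (y - u N.+1) - (y * y - u N * u N).
      by rewrite {1}uE; zmod.
    rewrite sqrB_sqr.
    rewrite (le_trans (cnormD _ _))// cnormN.
    have := cnormD (y - u N.+1) (y - u N.+1).
    have := cnormD (y * (y - u N)) ((y - u N) * u N).
    have := cnormM y (y - u N); have := cnormM (y - u N) (u N).
    have := yN N (leqnn N); have := yN N.+1 (leqnSn N).
    have := ut N; have /andP[_] := t01 N.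
    have := cnorm_ge0 (y - u N); have := cnorm_ge0 (y - u N.+1).
    have := cnorm_ge0 (u N); have := cnorm_ge0 y.
    move=> *.
    have : cnorm y * cnorm (y - u N) <= 1 * e by apply: ler_pM => //; exact: ltW.
    have : cnorm (y - u N) * cnorm (u N) <= e * 1.
      by apply: ler_pM => //; [exact: ltW|lra].
    lra.
  have -> : x = y + y - y * y by rewrite yE addrK.
  ncring.
- move=> xs; have us n : star (u n) = u n.
    elim: n => [|n IH]; first exact: star0.
    by rewrite /= -/(u n) /f star_rscale starD starM IH xs.
  apply/eqP; rewrite -subr_eq0; apply/eqP.
  apply: (u_fix (fun y => star y - y) 2) => //.
  - by move=> a b; rewrite starB; zmod.
  - move=> a; rewrite (le_trans (cnormD _ _))// cnormN cnorm_star.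
    by rewrite mulr_natl mulr2n.
  - by move=> n; rewrite us subrr.
- move=> z zx; have uz n : z * u n = u n * z.
    elim: n => [|n IH]; first by rewrite /= mulr0 mul0r.
    rewrite /= -/(u n) /f rscaleAl rscaleAr mulrDl mulrDr zx.
    by rewrite mulrA IH -!mulrA IH.
  apply/eqP; rewrite -subr_eq0; apply/eqP.
  apply: (u_fix (fun y => z * y - y * z) (2 * cnorm z)) => //.
  - by move=> a b; ncring.
  - move=> a; rewrite (le_trans (cnormD _ _))// cnormN.
    have := cnormM z a; have := cnormM a z; lra.
  - by have := cnorm_ge0 z; lra.
  - by move=> n; rewrite uz subrr.
Qed.

End SquareRoot.
(** * The positive cone *)

Section PositiveCone.
Variables (R : realType) (A : cstarAlgType R).
Implicit Types (a b x y z w : A) (r s t e : R).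

(** A provisional positive cone: its stability under sums follows from a norm criterion, whereas for
    [positive] it would already require Kaplansky's theorem. *)
Definition hsquare a := exists2 w, star w = w & a = w * w.

Lemma hsquare_star a : hsquare a -> star a = a.
Proof. by move=> [w ws ->]; rewrite starM ws. Qed.

Lemma rscale_star1 r : star (rscale r 1 : A) = rscale r 1.
Proof. by rewrite star_rscale star1. Qed.

Lemma rscaleMM r s a b : rscale r a * rscale s b = rscale (r * s) (a * b).
Proof. by rewrite rscaleAl rscaleAr rscaleA. Qed.

Lemma sqrt_mul_sqrt r : 0 <= r -> Num.sqrt r * Num.sqrt r = r.
Proof. by move=> r0; rewrite -expr2 sqr_sqrtr. Qed.

Lemma hsquareZ r a : 0 <= r -> hsquare a -> hsquare (rscale r a).
Proof.
move=> r0 [w ws ->]; exists (rscale (Num.sqrt r) w).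
  by rewrite star_rscale ws.
by rewrite rscaleMM sqrt_mul_sqrt.
Qed.

(** For [s > 0], scaling reduces this to a square root [1 - y] of [a / s]; for [s = 0] the bound
    forces [a = 0]. The last clause has the form of the hypothesis, so that a root of [w] can be
    extracted in turn. *)
Lemma sqrt_of_norm_le s a : star a = a -> cnorm (rscale s 1 - a) <= s ->
  exists w, [/\ star w = w, a = w * w, forall z, z * a = a * z -> z * w = w * z
    & cnorm (rscale (Num.sqrt s) 1 - w) <= Num.sqrt s].
Proof.
move=> as_ sa; have := le_trans (cnorm_ge0 _) sa.
rewrite le_eqVlt => /predU1P[s0|s0].
  move: sa; rewrite -s0 rscale0 sub0r cnormN => a0.
  have -> : a = 0.
    by apply: cnorm_eq0; apply/le_anti; rewrite a0 cnorm_ge0.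
  exists 0; rewrite star0 mulr0 sqrtr0 rscale0 subr0 cnorm0; split=> // z.
pose x := 1 - rscale s^-1 a.
have x1 : cnorm x <= 1.
  have -> : x = rscale s^-1 (rscale s 1 - a).
    by rewrite rscaleBr rscaleA mulVf ?gt_eqF// rscale1.
  by rewrite cnorm_rscale gtr0_norm ?invr_gt0// ler_pdivrMl// mulr1.
have [y [y1 yE ys yc]] := sqrt_one_sub x1.
have {}ys : star y = y by apply: ys; rewrite starB star1 star_rscale as_.
exists (rscale (Num.sqrt s) (1 - y)); split.
- by rewrite star_rscale starB star1 ys.
- rewrite rscaleMM sqrt_mul_sqrt ?ltW// yE /x opprB addrC subrK.
  by rewrite rscaleA divff ?gt_eqF// rscale1.
- move=> z za; rewrite rscaleAl rscaleAr mulrBr mulrBl mulr1 mul1r yc//.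
  by rewrite /x mulrBr mulrBl mulr1 mul1r rscaleAl rscaleAr za.
- rewrite rscaleBr opprB addrC subrK cnorm_rscale ger0_norm ?sqrtr_ge0//.
  by rewrite ler_piMr ?sqrtr_ge0.
Qed.

Lemma mulCii : 'i * 'i = -1 :> R[i].
Proof. by rewrite -expr2 sqrCi. Qed.

(* [v + i w] is unitary. *)
Lemma cnorm_unit_circle v w : star v = v -> star w = w -> v * w = w * v ->
  v * v + w * w = 1 -> cnorm w <= 1.
Proof.
move=> vs ws vw vw1; pose u := v + 'i *: w.
have su : star u = v - 'i *: w by rewrite starD starZ conjCi vs ws scaleNr.
have u1 : cnorm u <= 1.
  have : cnorm u ^+ 2 <= 1.
    rewrite -cnormE2 (_ : star u * u = 1) ?cnorm1// su -vw1 /u.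
    rewrite mulrDr mulrBl mulrBl -!scalerAl_cstar -!scalerAr_cstar scalerA.
    rewrite mulCii scaleN1r -vw; zmod.
  by have := cnorm_ge0 u; rewrite expr2 => *; nra.
(* Twice [w] is, up to the factor ['i], the difference of two elements of norm at most [1]. *)
have uu : 'i *: (w + w) = u - star u by rewrite su scalerDr /u; zmod.
have := cnormD u (- star u); rewrite -uu cnormZi cnormN cnorm_star.
rewrite -(rscale2 w) cnorm_rscale ger0_norm//.
by move=> *; lra.
Qed.

(** After scaling, [b] and [1 - b] are squares of the commuting self-adjoint elements [w / sqrt s]
    and [1 - y], whose squares add up to [1]; hence [1 - y] has norm at most [1]. *)
Lemma hsquare_norm_le s a : hsquare a -> cnorm a <= s ->
  cnorm (rscale s 1 - a) <= s.
Proof.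
move=> [w ws aE] a_s; have := le_trans (cnorm_ge0 _) a_s.
rewrite le_eqVlt => /predU1P[s0|s0].
  have -> : a = 0.
    by apply: cnorm_eq0; apply/le_anti; rewrite cnorm_ge0 andbT s0.
  by rewrite -s0 rscale0 subr0 cnorm0.
pose b := rscale s^-1 a.
have b1 : cnorm b <= 1.
  by rewrite cnorm_rscale gtr0_norm ?invr_gt0// ler_pdivrMl// mulr1.
have [y [y1 yE ys yc]] := sqrt_one_sub b1.
have {}ys : star y = y by apply: ys; rewrite /b star_rscale aE starM ws.
have {}yc : w * y = y * w.
  by apply: yc; rewrite /b rscaleAl rscaleAr aE mulrA.
have c1 : cnorm (1 - y) <= 1.
  apply: (@cnorm_unit_circle (rscale (Num.sqrt s^-1) w)).
  - by rewrite star_rscale ws.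
  - by rewrite starB star1 ys.
  - by rewrite rscaleAl rscaleAr mulrBr mulrBl yc mul1r mulr1.
  - by rewrite rscaleMM sqrt_mul_sqrt ?invr_ge0 ?ltW// -aE yE; rewrite addrC subrK.
have -> : rscale s 1 - a = rscale s (1 - b).
  by rewrite rscaleBr rscaleA divff ?gt_eqF// rscale1.
rewrite cnorm_rscale gtr0_norm// -yE ler_piMr ?(ltW s0)//.
rewrite (le_trans (cnormM _ _))//.
by have := cnorm_ge0 (1 - y); nra.
Qed.

Lemma hsquare_of_norm_le s a : star a = a -> cnorm (rscale s 1 - a) <= s ->
  hsquare a.
Proof. by move=> as_ /(sqrt_of_norm_le as_)[w [ws -> _ _]]; exists w. Qed.

(** The norm criterion is additive in both [s] and [a], by the triangle inequality. *)
Lemma hsquareD a b : hsquare a -> hsquare b -> hsquare (a + b).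
Proof.
move=> ha hb; apply: (@hsquare_of_norm_le (cnorm a + cnorm b)).
  by rewrite starD !hsquare_star.
have -> : rscale (cnorm a + cnorm b) 1 - (a + b) =
    (rscale (cnorm a) 1 - a) + (rscale (cnorm b) 1 - b).
  by rewrite rscaleDl; zmod.
by rewrite (le_trans (cnormD _ _))// lerD// hsquare_norm_le.
Qed.

Lemma hsquare_normB s a : star a = a -> cnorm a <= s -> hsquare (rscale s 1 - a).
Proof.
move=> as_ a_s; apply: (@hsquare_of_norm_le s).
  by rewrite starB rscale_star1 as_.
by rewrite opprB addrC subrK.
Qed.

Lemma hsquare1 r : 0 <= r -> hsquare (rscale r 1).
Proof. by move=> r0; apply: hsquareZ => //; exists 1; rewrite ?star1 ?mulr1. Qed.

Lemma cnorm_le_of_hsquare s a : 0 <= s -> hsquare a ->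
  hsquare (rscale s 1 - a) -> cnorm a <= s.
Proof.
(* Each root commutes with whatever commutes with its square. So the root [v] of [1 - b] commutes
   with [b], and then with the root [w] of [b], which makes [v + i w] unitary. *)
have le1 b : hsquare b -> hsquare (1 - b) -> cnorm b <= 1.
  move=> hb hb1.
  have [w [ws bE wc _]] :=
    sqrt_of_norm_le (hsquare_star hb) (hsquare_norm_le hb (lexx _)).
  have [v [vs vE vc _]] :=
    sqrt_of_norm_le (hsquare_star hb1) (hsquare_norm_le hb1 (lexx _)).
  have bv : b * v = v * b by apply: vc; ncring.
  have w1 : cnorm w <= 1.
    apply: (@cnorm_unit_circle v) => //; first exact: wc.
    by rewrite -vE -bE subrK.
  by rewrite bE (le_trans (cnormM _ _))//; have := cnorm_ge0 w; nra.
have lt0 t b : 0 < t -> hsquare b -> hsquare (rscale t 1 - b) -> cnorm b <= t.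
  move=> t0 hb hbt; have ti : 0 <= t^-1 by rewrite invr_ge0 ltW.
  have := le1 (rscale t^-1 b) (hsquareZ ti hb).
  have -> : 1 - rscale t^-1 b = rscale t^-1 (rscale t 1 - b).
    by rewrite rscaleBr rscaleA mulVf ?gt_eqF// rscale1.
  move=> /(_ (hsquareZ ti hbt)).
  by rewrite cnorm_rscale gtr0_norm ?invr_gt0// ler_pdivrMl// mulr1.
(* The scaling divides by the bound, so [s] is replaced by [s + e] to include [s = 0]. *)
move=> s0 ha has; apply/ler_addgt0Pr => e e0; apply: lt0 => //; first lra.
rewrite rscaleDl (_ : _ - a = (rscale s 1 - a) + rscale e 1); last by zmod.
by apply: hsquareD => //; apply: hsquare1; exact: ltW.
Qed.

Lemma hsquare_anti a : hsquare a -> hsquare (- a) -> a = 0.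
Proof.
move=> ha hNa; apply: cnorm_eq0; apply/le_anti; rewrite cnorm_ge0 andbT.
by apply: cnorm_le_of_hsquare => //; rewrite rscale0 sub0r.
Qed.

Lemma hsquare_le_cnorm a b : hsquare a -> hsquare (b - a) -> cnorm a <= cnorm b.
Proof.
move=> ha hba; apply: cnorm_le_of_hsquare => //; first exact: cnorm_ge0.
have -> : rscale (cnorm b) 1 - a = (rscale (cnorm b) 1 - b) + (b - a) by zmod.
apply: hsquareD => //; apply: hsquare_normB => //.
by rewrite -[b](subrK a) starD !hsquare_star.
Qed.

(* [n * n] is the absolute value of [a], so [d] is twice its negative part. *)
Lemma abs_defect a : star a = a -> exists n, let d := n * n - a in
  [/\ star n = n, n * d = d * n & a * d = - (n * n * d)].
Proof.
move=> as_.
have haa : hsquare (a * a) by exists a.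
have [m [ms mE mc mn]] :=
  sqrt_of_norm_le (hsquare_star haa) (hsquare_norm_le haa (lexx _)).
have [n [ns nE nc _]] := sqrt_of_norm_le ms mn.
have am : a * m = m * a by apply: mc; rewrite mulrA.
have an : a * n = n * a by apply: nc.
exists n => /=; split=> //.
  by rewrite mulrBr mulrBl an mulrA.
by rewrite -nE !mulrBr -am mE; zmod.
Qed.

(* Normalise [z] and put [p = z z^*], [q = - z^* z]. Since [p + p] differs from
   [q + q] by a sum of two squares, [p >= 0], so that [(1 - p) z = z (1 + q)] has
   norm at most [1], that is [(1 + q) q (1 + q) <= 1]. This forces [q <= 1 / 2],
   although [q] has norm [1]. *)
Lemma hsquare_opp_star_mul z : hsquare (- (star z * z)) -> z = 0.
Proof.
have no_unit y : cnorm y = 1 -> ~ hsquare (- (star y * y)).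
  move=> y1; set q := - (star y * y) => hq; pose p := y * star y.
  have q1 : cnorm q = 1 by rewrite cnormN cnormE2 y1 expr1n.
  have hp : hsquare p.
    have hpp : hsquare (p + p).
      have -> : p + p = (y + star y) * (y + star y)
          + ('i *: (y - star y)) * ('i *: (y - star y)) + (q + q).
        rewrite -scalerAl_cstar -scalerAr_cstar scalerA mulCii scaleN1r.
        rewrite /p /q; ncring.
      apply: hsquareD; last exact: hsquareD.
      apply: hsquareD; first by exists (y + star y); rewrite ?star_addC.
      by exists ('i *: (y - star y)); rewrite ?star_imag.
    rewrite -[p]rscale1 -(@mulVf _ 2) ?pnatr_eq0// -rscaleA rscale2.
    by apply: hsquareZ => //; rewrite invr_ge0.
  have p1 : cnorm p <= 1.
    by have := cnormE2 (star y); rewrite starK -/p cnorm_star y1 expr1n => ->.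
  pose t := (1 - p) * y.
  have tE : t = y * (1 + q) by rewrite /t /p /q; ncring.
  have qs : star q = q by exact: hsquare_star.
  have ttE : star t * t = - ((1 + q) * q * (1 + q)).
    rewrite tE starM starD star1 qs -mulrA (mulrA (star y)).
    by rewrite -[star y * y]opprK -/q mulNr mulrN mulrA.
  have t1 : cnorm t <= 1.
    rewrite (le_trans (cnormM _ _))// y1 mulr1.
    by have := hsquare_norm_le hp p1; rewrite rscale1.
  have h1 : hsquare (1 - (1 + q) * q * (1 + q)).
    rewrite -[X in X - _]rscale1; apply: hsquare_normB.
      by rewrite !starM !starD !star1 qs mulrA.
    by rewrite -cnormN -ttE cnormE2; have := cnorm_ge0 t; nra.
  have h2 : hsquare (q * q * q).
    have [w ws ->] := hq; exists (w * w * w); last by rewrite !mulrA.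
    by rewrite !starM ws mulrA.
  have h3 : hsquare ((q + q - 1) * (q + q - 1)).
    by exists (q + q - 1); rewrite // starB starD star1 qs.
  have hr : hsquare (rscale 3 1 - rscale 6 q).
    (* The added cubes cancel the cubic part of twice [1 - (1 + q) q (1 + q)], and the last square
       absorbs the quadratic part. What remains says [6 q <= 3]. *)
    have -> : rscale 3 1 - rscale 6 q =
        (1 - (1 + q) * q * (1 + q)) + (1 - (1 + q) * q * (1 + q))
        + (q * q * q + q * q * q) + (q + q - 1) * (q + q - 1).
      rewrite /rscale !rmorph_nat !scaler_nat !mulrS !mulr0n; ncring.
    by do 3![apply: hsquareD => //].
  have := cnorm_le_of_hsquare (ler0n R 3) (hsquareZ (ler0n R 6) hq) hr.
  by rewrite cnorm_rscale q1 mulr1 ger0_norm// ler_nat.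
move=> hz; apply: cnorm_eq0; apply/eqP/contraT => z0; exfalso.
have z_gt0 : 0 < cnorm z by rewrite lt_neqAle eq_sym z0 cnorm_ge0.
apply: (no_unit (rscale (cnorm z)^-1 z)).
  by rewrite cnorm_rscale gtr0_norm ?invr_gt0// mulVf.
rewrite star_rscale rscaleMM -rscaleN; apply: hsquareZ => //.
by rewrite -expr2 sqr_ge0.
Qed.

(** With [n * n] the absolute value of [a] and [d] the defect [n * n - a], the element
    [star (b * d) * (b * d) = d * a * d] is minus the square of [n * d]. Hence [b * d = 0], then
    [n * d = 0], then [d * d = 0], and [a = n * n]. *)
Lemma hsquare_of_positive a : positive a -> hsquare a.
Proof.
move=> [b aE]; have as_ : star a = a by rewrite aE starM starK.
have [n [ns nd ad]] := abs_defect as_.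
set d := n * n - a in nd ad.
have ds : star d = d by rewrite starB starM ns as_.
have snd : star (n * d) = n * d by rewrite starM ns ds.
have bd0 : b * d = 0.
  apply: hsquare_opp_star_mul; exists (n * d) => //.
  rewrite starM ds -mulrA (mulrA (star b)) -aE ad mulrN opprK.
  by rewrite -[n * n * d]mulrA nd !mulrA.
have nd0 : n * d = 0.
  apply: star_mul_eq0; rewrite snd; apply: (@oppr_inj A); rewrite oppr0.
  have : star (b * d) * (b * d) = 0 by rewrite bd0 mulr0.
  rewrite starM ds -mulrA (mulrA (star b)) -aE ad mulrN => <-.
  by rewrite -[n * n * d]mulrA nd !mulrA.
have d0 : d = 0.
  apply: star_mul_eq0; rewrite ds {1}/d mulrBl ad -mulrA nd0 mulr0.
  by rewrite opprK addr0.
by exists n => //; rewrite -[LHS]addr0 -d0 /d addrC subrK.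
Qed.

Lemma positive_of_hsquare a : hsquare a -> positive a.
Proof. by move=> [w ws ->]; exists w; rewrite ws. Qed.

End PositiveCone.
(** * Positive maps and transfer operators *)

Section LinearMaps.
Variables (R : realType) (A : cstarAlgType R).
Implicit Types (a b x y : A) (f : A -> A).

Lemma linear_mapD f : linear f -> {morph f : a b / a + b}.
Proof. by move=> lf a b; have := lf 1 a b; rewrite !scale1r. Qed.

Lemma linear_map0 f : linear f -> f 0 = 0.
Proof. by move=> lf; apply: (addrI (f 0)); rewrite -linear_mapD// !addr0. Qed.

Lemma linear_mapZ f k : linear f -> {morph f : a / k *: a}.
Proof. by move=> lf a; have := lf k a 0; rewrite !addr0 linear_map0// addr0. Qed.

Lemma linear_map_rscale f r : linear f -> {morph f : a / rscale r a}.
Proof. by move=> lf a; exact: linear_mapZ. Qed.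

Lemma linear_mapN f : linear f -> {morph f : a / - a}.
Proof. by move=> lf a; rewrite -scaleN1r linear_mapZ// scaleN1r. Qed.

Lemma linear_mapB f : linear f -> {morph f : a b / a - b}.
Proof. by move=> lf a b; rewrite linear_mapD// linear_mapN. Qed.

Definition positive_map f := forall a, positive a -> positive (f a).

Lemma hsquare_map f a : positive_map f -> hsquare a -> hsquare (f a).
Proof. by move=> pf /positive_of_hsquare/pf/hsquare_of_positive. Qed.

Lemma double_inj a b : a + a = b + b -> a = b.
Proof.
rewrite -!rscale2 => /(congr1 (rscale 2^-1)).
by rewrite !rscaleA mulVf ?pnatr_eq0// !rscale1.
Qed.

Lemma hsquare_normD a : star a = a -> hsquare (rscale (cnorm a) 1 + a).
Proof.
move=> as_; rewrite -[a in _ + a]opprK -cnormN; apply: hsquare_normB => //.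
by rewrite starN as_.
Qed.

(** A self-adjoint [a] is the difference of the positive elements [cnorm a + a] and [cnorm a], so
    its image is self-adjoint. The general case follows from [a + star a] and
    ['i *: (a - star a)]. *)
Lemma positive_map_star f : linear f -> positive_map f ->
  {morph f : a / star a}.
Proof.
move=> lf pf.
have sa a : star a = a -> star (f a) = f a.
  move=> as_; pose s : A := rscale (cnorm a) 1.
  have -> : f a = f (s + a) - f s by rewrite -linear_mapB// addrC addKr.
  rewrite starB !hsquare_star//; apply: hsquare_map => //.
    by apply: hsquare1; exact: cnorm_ge0.
  exact: hsquare_normD.
move=> a; apply: double_inj.
have := sa _ (star_addC a); rewrite linear_mapD// starD => h1.
have := sa _ (star_imag a).
rewrite linear_mapZ// starZ conjCi scaleNr -scalerN => /(scalerI (neq0Ci _)).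
rewrite linear_mapB// starB => h2.
have -> : f (star a) + f (star a) =
    (f a + f (star a)) - (f a - f (star a)) by zmod.
by rewrite -h1 -h2; zmod.
Qed.

(** For self-adjoint [b] of norm [s], [f b] lies between [- s t] and [s t]; shifting by [s t] gives
    a positive element of norm at most [2 s t], hence the factor [3]. Splitting [a] into its two
    self-adjoint parts doubles it. *)
Lemma positive_map_bound f : linear f -> positive_map f ->
  forall a, cnorm (f a) <= 6 * cnorm (f 1) * cnorm a.
Proof.
move=> lf pf a; set t := cnorm (f 1).
have t0 : 0 <= t by exact: cnorm_ge0.
have h1 : hsquare (f 1 : A).
  by apply: hsquare_map => //; exists 1; rewrite ?star1 ?mulr1.
have ht : hsquare (rscale t 1 - f 1).
  by apply: hsquare_normB => //; exact: hsquare_star.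
have sa b : star b = b -> cnorm (f b) <= 3 * t * cnorm b.
  move=> bs; set s := cnorm b.
  have s0 : 0 <= s by exact: cnorm_ge0.
  have hD : hsquare (rscale s (f 1) + f b).
    rewrite -linear_map_rscale// -linear_mapD//; apply: hsquare_map => //.
    exact: hsquare_normD.
  have hB : hsquare (rscale s (f 1) - f b).
    rewrite -linear_map_rscale// -linear_mapB//; apply: hsquare_map => //.
    exact: hsquare_normB.
  have hst : hsquare (rscale (s * t) 1 - rscale s (f 1)).
    by rewrite -rscaleA -rscaleBr; exact: hsquareZ.
  have st0 : 0 <= s * t by exact: mulr_ge0.
  have : cnorm (rscale (s * t) 1 + f b) <= 2 * (s * t).
    apply: cnorm_le_of_hsquare; first by rewrite mulr_ge0.
      have -> : rscale (s * t) 1 + f b = rscale (s * t) 1 - rscale s (f 1)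
          + (rscale s (f 1) + f b) by zmod.
      exact: hsquareD.
    rewrite -rscaleA rscale2.
    have -> : rscale (s * t) 1 + rscale (s * t) 1 - (rscale (s * t) 1 + f b)
        = rscale (s * t) 1 - rscale s (f 1) + (rscale s (f 1) - f b) by zmod.
    exact: hsquareD.
  have := cnormD (rscale (s * t) 1 + f b) (- rscale (s * t) 1).
  rewrite addrAC subrr add0r cnormN cnorm_rscale ger0_norm//.
  have : (s * t) * cnorm (1 : A) <= s * t by rewrite ler_piMr// cnorm1.
  move=> *; lra.
have := sa _ (star_addC a); have := sa _ (star_imag a).
rewrite linear_mapZ// !cnormZi.
have := cnormD a (- star a); have := cnormD a (star a).
rewrite cnormN cnorm_star => n1 n2 m1 m2.
have fa2 : rscale 2 (f a) = f (a + star a) + f (a - star a).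
  by rewrite -linear_mapD// rscale2 -linear_mapD//; congr (f _); zmod.
have := cnormD (f (a + star a)) (f (a - star a)).
rewrite -fa2 cnorm_rscale ger0_norm// => m3.
have : t * cnorm (a + star a) <= t * (cnorm a + cnorm a) by exact: ler_wpM2l.
have : t * cnorm (a - star a) <= t * (cnorm a + cnorm a) by exact: ler_wpM2l.
by move=> *; lra.
Qed.

Lemma positive_map_continuous f : linear f -> positive_map f -> continuous f.
Proof.
move=> lf pf x; apply/cvgrPdist_lt => _ /gt0_complexE[e e0 ->].
(* The added [1] keeps [M] positive when [f 1 = 0]. *)
pose M := 6 * cnorm (f 1) + 1.
have M0 : 0 < M by rewrite ltr_wpDl// mulr_ge0// cnorm_ge0.
apply/nbhs_normP; exists (real_complex R (e / M)).
  by rewrite /= -(rmorph0 (real_complex R)) ltcR divr_gt0.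
move=> y; rewrite /ball_ /= !cnormE !ltcR ltr_pdivlMr// -linear_mapB// => xy.
apply: le_lt_trans (positive_map_bound lf pf _) (le_lt_trans _ xy).
by rewrite mulrC /M mulrDr mulr1 lerDl cnorm_ge0.
Qed.

End LinearMaps.

(** * From transfer operators to conditional expectations *)

Section TransferOperators.
Variables (R : realType) (A : cstarAlgType R) (alpha : A -> A).
Hypothesis alpha_endo : star_endomorphism alpha.
Implicit Types (a b x y : A) (L : A -> A).

Let alpha_linear : linear alpha. Proof. by case: alpha_endo. Qed.
Let alphaM : {morph alpha : a b / a * b}. Proof. by case: alpha_endo. Qed.
Let alpha_star : {morph alpha : a / star a}. Proof. by case: alpha_endo. Qed.

Lemma endo_positive : positive_map alpha.
Proof. by move=> _ [b ->]; exists (alpha b); rewrite alphaM alpha_star. Qed.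

Lemma endo_mul1l a : alpha 1 * alpha a = alpha a.
Proof. by rewrite -alphaM mul1r. Qed.

Lemma endo_mul1r a : alpha a * alpha 1 = alpha a.
Proof. by rewrite -alphaM mulr1. Qed.

(** The adjoint of the transfer identity, available because a positive linear map preserves
    [star]. *)
Lemma transfer_mulr L a b : transfer_operator alpha L ->
  L (b * alpha a) = L b * a.
Proof.
move=> [lL _ pL LE]; have Ls := positive_map_star lL pL.
rewrite -[LHS]starK -Ls starM -alpha_star LE starM starK.
by rewrite Ls starK.
Qed.

Lemma transfer_kernel_mul L a : transfer_operator alpha L -> alpha a = 0 ->
  forall b, L b * a = 0.
Proof.
move=> TL a0 b; rewrite -transfer_mulr// a0 mulr0.
exact: linear_map0 (transfer_linear TL).
Qed.

Lemma transfer_kernel_unital L : nondegenerate_transfer alpha L ->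
  unital_subset (endo_kernel alpha).
Proof.
move=> [TL L1]; exists (1 - L 1).
  by rewrite /endo_kernel /= linear_mapB// L1 subrr.
move=> a a0; rewrite mulrBl mulrBr mul1r mulr1.
by rewrite (transfer_kernel_mul TL a0) -(transfer_identity TL) a0 mul0r
  (linear_map0 (transfer_linear TL)) subr0.
Qed.

Lemma endo_transferK L a : nondegenerate_transfer alpha L ->
  alpha (L (alpha a)) = alpha a.
Proof.
by move=> [TL L1]; rewrite -{1}[alpha a]mulr1 (transfer_identity TL)
  alphaM L1 endo_mul1r.
Qed.

(* The Kadison-Schwarz inequality [E x^* E x <= E (x^* x)] for [E = alpha L]
   is positivity of [E] at [(x - E x)^* (x - E x)]. *)
Lemma endo_transfer_contractive L : nondegenerate_transfer alpha L ->
  forall x, cnorm (alpha (L x)) <= cnorm x.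
Proof.
move=> nL x; have [TL L1] := nL; have [lL _ pL LE] := TL.
have Ls := positive_map_star lL pL.
pose f y := alpha (L y); pose h := star x * x; pose c := L x.
have hf y : hsquare y -> hsquare (f y).
  by move=> hy; apply: hsquare_map endo_positive (hsquare_map pL hy).
have fB y z : f (y - z) = f y - f z by rewrite /f !linear_mapB.
have hh : hsquare h by apply: hsquare_of_positive; exists x.
have fh : cnorm (f h) <= cnorm x ^+ 2.
  apply: cnorm_le_of_hsquare; [exact: sqr_ge0|exact: hf|].
  (* Since [f 1] is only the projection [alpha 1], its complement [1 - alpha 1] has to be added; it
     is the square of itself. *)
  have -> : rscale (cnorm x ^+ 2) 1 - f h = rscale (cnorm x ^+ 2) (1 - alpha 1)
      + f (rscale (cnorm x ^+ 2) 1 - h).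
    rewrite fB {2}/f !linear_map_rscale// L1 rscaleBr; zmod.
  apply: hsquareD.
    apply: hsquareZ; first exact: sqr_ge0.
    exists (1 - alpha 1); first by rewrite starB -alpha_star star1.
    have := endo_mul1l 1 => pp; rewrite mulrBl !mulrBr pp; ncring.
  apply: hf; apply: hsquare_normB; first exact: hsquare_star.
  by rewrite cnormE2.
(* Both mixed terms and the last term of the expansion map to [star (alpha c) * alpha c], by the
   module property on either side. *)
have fx : f (star (x - alpha c) * (x - alpha c)) = f h - star (alpha c) * alpha c.
  have -> : star (x - alpha c) * (x - alpha c) =
      h - star x * alpha c - (alpha (star c) * x - alpha (star c * c)).
    rewrite starB alphaM -alpha_star /h; ncring.
  rewrite !fB [f (alpha (_ * _))]endo_transferK// {2 3}/f transfer_mulr// LE.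
  by rewrite Ls -/c !alphaM alpha_star; zmod.
have : cnorm (star (alpha c) * alpha c) <= cnorm (f h).
  apply: hsquare_le_cnorm; first by apply: hsquare_of_positive; exists (alpha c).
  by rewrite -fx; apply: hf; apply: hsquare_of_positive; exists (x - alpha c).
rewrite cnormE2 => /le_trans/(_ fh).
by rewrite ler_sqr ?nnegrE ?cnorm_ge0.
Qed.

Lemma expectation_of_transfer L : nondegenerate_transfer alpha L ->
  conditional_expectation (range alpha) (expectation_of alpha L).
Proof.
move=> nL; have [TL L1] := nL; have [lL _ pL LE] := TL.
rewrite /expectation_of; split.
- by move=> _ [a _ <-]; exists (alpha a); rewrite // endo_mul1l endo_mul1r.
- by move=> x; exists (L (\val x)).
- by move=> x [a _ <-]; exact: endo_transferK.
- by move=> k x y z ->; rewrite lL alpha_linear.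
- by move=> x px; apply: endo_positive; exact: pL.
- by move=> x; rewrite !cnormE lecR; exact: endo_transfer_contractive.
- by move=> _ x y [a _ <-] ->; rewrite LE alphaM.
- by move=> _ x y [a _ <-] ->; rewrite transfer_mulr// alphaM.
Qed.

(** * Unital kernels and the inverse on the annihilator *)

Section UnitalKernel.
Hypothesis ker_unital : unital_subset (endo_kernel alpha).

(** The kernel is a two-sided ideal, so [u * a] and [a * u] both equal [u * a * u] and [u] is
    central. Membership in the annihilator then becomes the single equation [a * u = 0]. *)
Lemma kernel_unit : exists u, [/\ alpha u = 0,
  forall a, alpha a = 0 -> u * a = a, forall a, u * a = a * u &
  forall a, annihilator (endo_kernel alpha) a <-> a * u = 0].
Proof.
have [u u0 uE] := ker_unital; exists u.
have uc a : u * a = a * u.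
  have ua : endo_kernel alpha (u * a).
    by rewrite /endo_kernel /= alphaM (_ : alpha u = 0)// mul0r.
  have au : endo_kernel alpha (a * u).
    by rewrite /endo_kernel /= alphaM (_ : alpha u = 0)// mulr0.
  by rewrite -(uE _ ua).2 -mulrA (uE _ au).1.
split=> // [a /uE[] //|a]; split=> [|au0 b /uE[b1 _]]; first exact.
by rewrite -b1 mulrA au0 mul0r.
Qed.

Lemma annihilator_endo_inj x y : annihilator (endo_kernel alpha) x ->
  annihilator (endo_kernel alpha) y -> alpha x = alpha y -> x = y.
Proof.
have [u [u0 uE uc ann]] := kernel_unit => /ann xu /ann yu xy.
have xy0 : alpha (x - y) = 0 by rewrite linear_mapB// xy subrr.
apply/eqP; rewrite -subr_eq0; apply/eqP.
by rewrite -(uE _ xy0) uc mulrBl xu yu subrr.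
Qed.

Lemma annihilator_endo_surj a :
  exists2 x, annihilator (endo_kernel alpha) x & alpha x = alpha a.
Proof.
(* The witness is the component of [a] in the complementary summand, cut out by the central element
   [1 - u]. *)
have [u [u0 uE uc ann]] := kernel_unit; exists (a - a * u).
  by apply/ann; rewrite mulrBl -mulrA (uE _ u0) subrr.
by rewrite linear_mapB// alphaM u0 mulr0 subr0.
Qed.

Lemma annihilator_endo_bij :
  set_bij (annihilator (endo_kernel alpha)) (range alpha) alpha.
Proof.
split; first by move=> x _; exists x.
  by move=> x y /set_mem xa /set_mem ya; exact: annihilator_endo_inj.
move=> _ [a _ <-]; have [x xa xE] := annihilator_endo_surj a.
by exists x.
Qed.

Lemma annihilator_mull a x : annihilator (endo_kernel alpha) x ->
  annihilator (endo_kernel alpha) (a * x).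
Proof. by move=> xa b /xa xb; rewrite -mulrA xb mulr0. Qed.

Lemma annihilator_linear k x y : annihilator (endo_kernel alpha) x ->
  annihilator (endo_kernel alpha) y -> annihilator (endo_kernel alpha) (k *: x + y).
Proof.
move=> xa ya b kb; rewrite mulrDl -scalerAl_cstar (xa _ kb) (ya _ kb).
by rewrite scaler0 addr0.
Qed.

(* With [d = |x| - x], positivity of [alpha x] makes both [alpha (d * x * d)]
   and its opposite positive, so that [alpha d = 0]. *)
Lemma annihilator_positive x : annihilator (endo_kernel alpha) x ->
  positive (alpha x) -> positive x.
Proof.
move=> xa pax; have [u [u0 uE uc ann]] := kernel_unit.
have us : star u = u.
  have su0 : alpha (star u) = 0.
    by rewrite alpha_star u0 star0.
  by have := congr1 (@star R A) (uE _ su0); rewrite starM !starK uE.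
have sxa : annihilator (endo_kernel alpha) (star x).
  by apply/ann; rewrite -uc -us -starM (ann x).1// star0.
have xs : star x = x.
  apply: annihilator_endo_inj => //; rewrite alpha_star.
  exact: hsquare_star (hsquare_of_positive pax).
have [n [ns nd xd]] := abs_defect xs; set d := n * n - x in nd xd.
have ds : star d = d by rewrite starB starM ns xs.
have dxd : d * x * d = - ((n * d) * (n * d)).
  by rewrite -mulrA xd mulrN -[n * n * d]mulrA nd !mulrA.
have nds : star (alpha (n * d)) = alpha (n * d).
  by rewrite -alpha_star starM ns ds nd.
have nd0 : alpha (n * d) = 0.
  apply: star_mul_eq0; rewrite nds -alphaM.
  apply: hsquare_anti; first by exists (alpha (n * d)) => //; rewrite alphaM.
  rewrite -linear_mapN// -dxd; apply: hsquare_of_positive.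
  case: pax => b bE; exists (b * alpha d).
  by rewrite !alphaM bE starM -alpha_star ds !mulrA.
have d0 : alpha d = 0.
  apply: star_mul_eq0; rewrite -alpha_star ds -alphaM {1}/d mulrBl xd opprK.
  by rewrite -mulrA linear_mapD// !alphaM -alphaM nd0 mulr0 addr0.
(* Here [n * n = d + x], where [d] lies in the kernel and [x] in the annihilator. The factor [1 - u]
   kills [d] and fixes [x]. *)
exists (n * (1 - u)); rewrite starM starB star1 us ns.
have xu : x * (1 - u) = x by rewrite mulrBr mulr1 (ann x).1// subr0.
have du : d * (1 - u) = 0 by rewrite mulrBr mulr1 -uc uE// subrr.
have -> : (1 - u) * n * (n * (1 - u)) = (1 - u) * (d * (1 - u) + x * (1 - u)).
  by rewrite -mulrDl /d subrK !mulrA.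
by rewrite du add0r xu mulrBl mul1r uc (ann x).1// subr0.
Qed.

Lemma kernel_perp_inv_annihilator y : range alpha y ->
  annihilator (endo_kernel alpha) (kernel_perp_inv alpha y).
Proof.
have [_ _ surj] := annihilator_endo_bij.
by move=> ry; apply: (surjpinv_image_sub surj); exists y.
Qed.

Lemma kernel_perp_invK y : range alpha y -> alpha (kernel_perp_inv alpha y) = y.
Proof.
have [_ _ surj] := annihilator_endo_bij.
by move=> ry; exact: (surjpK _ surj (mem_set ry)).
Qed.

Lemma kernel_perp_inv_endo x : annihilator (endo_kernel alpha) x ->
  kernel_perp_inv alpha (alpha x) = x.
Proof.
move=> xa; have rx : range alpha (alpha x) by exists x.
apply: annihilator_endo_inj => //; last exact: kernel_perp_invK.
exact: kernel_perp_inv_annihilator.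
Qed.

Lemma to_corner_val (x : corner (alpha 1)) : to_corner (alpha 1) (\val x) = x.
Proof.
apply: val_inj => /=; have := set_valP x; case=> a _ <-.
by rewrite !mulrA endo_mul1l -!mulrA endo_mul1l.
Qed.

(** * From conditional expectations to transfer operators *)

Section TransferOfExpectation.
Variable E : corner (alpha 1) -> A.
Hypothesis E_condexp : conditional_expectation (range alpha) E.
Let L := transfer_of alpha E.

Lemma transfer_of_annihilator a : annihilator (endo_kernel alpha) (L a).
Proof. by apply: kernel_perp_inv_annihilator; exact: (condexp_range E_condexp). Qed.

Lemma endo_transfer_of a : alpha (L a) = E (to_corner (alpha 1) a).
Proof. by apply: kernel_perp_invK; exact: (condexp_range E_condexp). Qed.

(** The values of [L] lie in the annihilator, where [alpha] is injective and reflects positivity. So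
    linearity, positivity and the transfer identity can be tested after applying [alpha], where they
    become properties of [E]. *)
Lemma transfer_of_nondegenerate : nondegenerate_transfer alpha L.
Proof.
have lL : linear L.
  move=> k a b; apply: annihilator_endo_inj; first exact: transfer_of_annihilator.
    by apply: annihilator_linear; exact: transfer_of_annihilator.
  rewrite alpha_linear !endo_transfer_of; apply: (condexp_linear E_condexp) => /=.
  by rewrite mulrDr mulrDl -scalerAr_cstar -scalerAl_cstar.
have pL : positive_map L.
  move=> _ [b ->]; apply: annihilator_positive; first exact: transfer_of_annihilator.
  rewrite endo_transfer_of; apply: (condexp_positive E_condexp) => /=.
  exists (b * alpha 1); rewrite starM -alpha_star star1; ncring.
split; last first.
  rewrite endo_transfer_of (condexp_id E_condexp) /= ?mulr1 ?endo_mul1l//.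
  by exists 1.
split=> //; first exact: positive_map_continuous.
move=> a b; apply: annihilator_endo_inj; first exact: transfer_of_annihilator.
  by apply: annihilator_mull; exact: transfer_of_annihilator.
rewrite alphaM !endo_transfer_of; apply: (condexp_left E_condexp) => /=.
  by exists a.
by rewrite !mulrA endo_mul1l endo_mul1r.
Qed.

Lemma transfer_ofK : expectation_of alpha L = E.
Proof.
by apply/funext => x; rewrite /expectation_of endo_transfer_of to_corner_val.
Qed.

End TransferOfExpectation.

(** Compressing by [alpha 1] does not change [L a], by the transfer identity on both sides; and
    [L a] annihilates the kernel, so [kernel_perp_inv] recovers it from its image. *)
Lemma expectation_ofK L : nondegenerate_transfer alpha L ->
  transfer_of alpha (expectation_of alpha L) = L.
Proof.
move=> [TL _]; apply/funext => a; rewrite /transfer_of /expectation_of /=.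
rewrite transfer_mulr// mulr1 (transfer_identity TL) mul1r.
by apply: kernel_perp_inv_endo => b b0; exact: transfer_kernel_mul TL b0 a.
Qed.

End UnitalKernel.
End TransferOperators.

(** * The one-to-one correspondence *)

Lemma set_bij_of_cancel (T U : Type) (B : set T) (C : set U)
    (f : T -> U) (g : U -> T) :
  set_fun B C f -> set_fun C B g ->
  {in B, cancel f g} -> {in C, cancel g f} -> set_bij B C f.
Proof.
move=> fBC gCB fK gK; split=> //; first exact: can_in_inj fK.
by move=> y Cy; exists (g y); [exact: gCB|exact/gK/mem_set].
Qed.

Theorem theorem1p6 (R : realType) (A : cstarAlgType R) (alpha : A -> A)
    (alpha_endo : star_endomorphism alpha) :
  ((exists L : A -> A, nondegenerate_transfer alpha L) <->
   (unital_subset (endo_kernel alpha) /\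
    exists E : corner (alpha 1) -> A,
      conditional_expectation (range alpha) E)) /\
  (unital_subset (endo_kernel alpha) ->
   [/\ set_bij (annihilator (endo_kernel alpha)) (range alpha) alpha,
       set_bij (nondegenerate_transfers alpha) (corner_expectations alpha)
         (expectation_of alpha),
       set_bij (corner_expectations alpha) (nondegenerate_transfers alpha)
         (transfer_of alpha),
       {in nondegenerate_transfers alpha,
         cancel (expectation_of alpha) (transfer_of alpha)} &
       {in corner_expectations alpha,
         cancel (transfer_of alpha) (expectation_of alpha)}]).
Proof.
split; first split.
- move=> [L nL]; split; first exact: transfer_kernel_unital nL.
  by exists (expectation_of alpha L); exact: expectation_of_transfer.
- move=> [ku [E cE]]; exists (transfer_of alpha E).
  exact: transfer_of_nondegenerate.
move=> ku.
have fLE : set_fun (nondegenerate_transfers alpha) (corner_expectations alpha)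
    (expectation_of alpha) by move=> L nL; exact: expectation_of_transfer.
have fEL : set_fun (corner_expectations alpha) (nondegenerate_transfers alpha)
    (transfer_of alpha) by move=> E cE; exact: transfer_of_nondegenerate.
have LK : {in nondegenerate_transfers alpha,
    cancel (expectation_of alpha) (transfer_of alpha)}.
  by move=> L /set_mem nL; exact: expectation_ofK.
have EK : {in corner_expectations alpha,
    cancel (transfer_of alpha) (expectation_of alpha)}.
  by move=> E /set_mem cE; exact: transfer_ofK.
split=> //; first exact: annihilator_endo_bij.
- exact: set_bij_of_cancel fLE fEL LK EK.
- exact: set_bij_of_cancel fEL fLE EK LK.
Qed.
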